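(* Let $\mathcal{S}=\{S_d:\mathcal{H}_d\to\mathcal{G}_d\}_{d\in\mathbb{N}}$ be a sequence of compact linear operators between Hilbert spaces, with eigenvalues $\lambda_{d,1}\ge\lambda_{d,2}\ge\cdots\ge 0$ of $S_d^*S_d$. Fix an error criterion, ABS or NOR, and let $\mathrm{CRI}_d=1$ for ABS and $\mathrm{CRI}_d=\lambda_{d,1}$ for NOR. For $\tau_1,\tau_3\ge 0$ and $\tau_2,\widetilde C>0$ consider the condition $$(\ast)\qquad M:=\sup_{d\in\mathbb{N}}\, d^{-\tau_1}\sum_{j=\lceil \widetilde C\, d^{\tau_3}\rceil}^{\infty}\left(\frac{\lambda_{d,j}}{\mathrm{CRI}_d}\right)^{j^{-\tau_2}}<\infty .$$ Then: (i) $\mathcal{S}$ is EXP-PT-ABS iff there exist $\tau_1,\tau_3\ge0$ and $\tau_2,\widetilde C>0$ such that $(\ast)$ holds (with $\mathrm{CRI}_d=1$). (ii) $\mathcal{S}$ is EXP-PT-NOR iff there exist $\tau_1\ge0$ and $\tau_2>0$ such that $(\ast)$ holds with $\mathrm{CRI}_d=\lambda_{d,1}$, $\widetilde C=1$ and $\tau_3=0$. (iii) $\mathcal{S}$ is EXP-SPT-ABS iff there exist $\tau_2,\widetilde C>0$ such that $(\ast)$ holds with $\mathrm{CRI}_d=1$ and $\tau_1=\tau_3=0$. (iv) $\mathcal{S}$ is EXP-SPT-NOR iff there exists $\tau_2>0$ such that $(\ast)$ holds with $\mathrm{CRI}_d=\lambda_{d,1}$, $\widetilde C=1$ and $\tau_1=\tau_3=0$.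 Moreover, in each of the cases (i)--(iv), if $(\ast)$ holds for the respective parameters, then for all $\varepsilon>0$ and $d\in\mathbb{N}$ the information complexity for the respective error criterion satisfies $$n_{\mathrm{ABS}/\mathrm{NOR}}(\varepsilon,S_d)\le \lfloor M\,\mathrm{e}\,d^{\tau_1}\rfloor+\lceil\widetilde C\,d^{\tau_3}\rceil+\left\lceil \max(0,2\ln\varepsilon^{-1})^{1/\tau_2}\right\rceil .$$ In cases (iii) and (iv), if $\mathcal{S}$ is EXP-SPT-ABS (respectively EXP-SPT-NOR), the exponent of EXP-SPT-ABS (respectively EXP-SPT-NOR) is $$p^*=\inf\{1/\tau_2:\ \tau_2 \text{ satisfies } (\ast)\},$$ where $\tau_2$ ranges over all $\tau_2>0$ for which $(\ast)$ holds with parameters as in (iii) (for some $\widetilde C>0$), respectively as in (iv).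
   Context: Setting. $\mathbb{N}=\{1,2,\dots\}$, $\mathbb{N}_0=\mathbb{N}\cup\{0\}$. For each $d\in\mathbb{N}$, $\mathcal{H}_d$ and $\mathcal{G}_d$ are Hilbert spaces and $S_d:\mathcal{H}_d\to\mathcal{G}_d$ is a compact linear operator; $\mathcal{S}=\{S_d\}_{d\in\mathbb{N}}$. The operator $W_d=S_d^*S_d$ is compact, self-adjoint and positive semi-definite; $\lambda_{d,1}\ge\lambda_{d,2}\ge\cdots$ denote its eigenvalues in non-increasing order, counted with multiplicity (the positive ones are listed; if there are only finitely many, the sequence is continued by zeros). For the criterion NOR it is assumed that $S_d\neq0$, i.e. $\lambda_{d,1}=\|S_d\|^2>0$. Convention: $0^x=0$ for $x>0$. Information complexity. An algorithm $A_{d,n}:\mathcal{H}_d\to\mathcal{G}_d$ has $A_{d,0}=0$, and for $n\ge1$ has the form $A_{d,n}(f)=\phi_n(L_1(f),\dots,L_n(f))$ with an arbitrary map $\phi_n:\mathbb{C}^n\to\mathcal{G}_d$ and continuous linear functionals $L_j$ on $\mathcal{H}_d$, possibly chosen adaptively ($L_j$ may depend on $L_1(f),\dots,L_{j-1}(f)$). Its worst case error is $e(A_{d,n})=\sup_{\|f\|_{\mathcal{H}_d}\le1}\|S_d(f)-A_{d,n}(f)\|_{\mathcal{G}_d}$, and $e(n,S_d)=\inf_{A_{d,n}}e(A_{d,n})$. For $\varepsilon>0$, $n_{\mathrm{ABS}}(\varepsilon,S_d)=\min\{n\in\mathbb{N}_0: e(n,S_d)\le\varepsilon\}$ (absolute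 error criterion, ABS) and $n_{\mathrm{NOR}}(\varepsilon,S_d)=\min\{n\in\mathbb{N}_0: e(n,S_d)\le\varepsilon\|S_d\|\}$ (normalized error criterion, NOR). It is a known fact that $n_{\mathrm{ABS}}(\varepsilon,S_d)=\min\{n\in\mathbb{N}_0:\lambda_{d,n+1}\le\varepsilon^2\}$ and $n_{\mathrm{NOR}}(\varepsilon,S_d)=\min\{n\in\mathbb{N}_0:\lambda_{d,n+1}\le\varepsilon^2\lambda_{d,1}\}$; these formulas may be taken as the definition. Tractability notions (for ABS or NOR). EXP-SPT-ABS/NOR (strong polynomial tractability, exponential case): there are $C,p\ge0$ such that for all $d\in\mathbb{N}$, $\varepsilon>0$, $n_{\mathrm{ABS}/\mathrm{NOR}}(\varepsilon,S_d)\le C(1+\ln\max(1,\varepsilon^{-1}))^p$. The infimum of all $p$ for which such a bound holds (with some $C$) is the exponent $p^*$ of EXP-SPT-ABS/NOR. EXP-PT-ABS/NOR (polynomial tractability, exponential case): there are $C,p,q\ge0$ such that for all $d\in\mathbb{N}$, $\varepsilon>0$, $n_{\mathrm{ABS}/\mathrm{NOR}}(\varepsilon,S_d)\le C\,d^{q}(1+\ln\max(1,\varepsilon^{-1}))^p$. *)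

(* Defs.v *)
From HB Require Import structures.
From mathcomp Require Import all_boot all_order all_algebra.
From mathcomp Require Import complex.
From mathcomp Require Import all_classical all_reals all_analysis.

Set Implicit Arguments.
Unset Strict Implicit.
Unset Printing Implicit Defensive.

Import Order.TTheory GRing.Theory Num.Theory.
Import numFieldNormedType.Exports.

Local Open Scope classical_set_scope.
Local Open Scope ring_scope.
Local Open Scope complex_scope.

(* The norm of a normed module over R[i] takes its values in R[i], so
   [inner_norm] also says that [inner x x] is real and nonnegative, and it
   makes the form definite. *)
Record hilbertType (R : realType) := Hilbert {
  hilbert_sort :> completeNormedModType R[i];
  inner : hilbert_sort -> hilbert_sort -> R[i];
  inner_linear : forall (a : R[i]) (x y z : hilbert_sort),
    inner (a *: x + y) z = a * inner x z + inner y z;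
  inner_conj : forall x y : hilbert_sort, inner y x = (inner x y)^*;
  inner_norm : forall x : hilbert_sort, `|x| ^+ 2 = inner x x
}.

Section Operators.
Variable R : realType.
Implicit Types H G : hilbertType R.

Definition compact_op H G (S : H -> G) : Prop :=
  precompact (S @` [set f : H | `|f| <= 1]).

Definition adjoint_of H G (S : H -> G) (Sadj : G -> H) : Prop :=
  forall (f : H) (g : G), inner (S f) g = inner f (Sadj g).

Definition nonzero_op H G (S : H -> G) : Prop := exists f : H, S f != 0.

Definition lin_indep H (k : nat) (v : 'I_k -> H) : Prop :=
  forall c : 'I_k -> R[i],
    \sum_(i < k) c i *: v i = 0 -> forall i, c i = 0.

(* [a 1 >= a 2 >= ...] lists the positive eigenvalues of [W] with multiplicity,
   followed by zeros if there are finitely many of them: every [mu > 0] occurs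
   among the [a j] exactly [dim ker (W - mu)] times.  The value [a 0] is
   irrelevant. *)
Definition eigenvalue_seq H (W : H -> H) (a : nat -> R) : Prop :=
  [/\ forall j, (0 < j)%N -> 0 <= a j,
      forall j, (0 < j)%N -> a j.+1 <= a j
    & forall mu : R, 0 < mu -> forall k : nat,
        (exists v : 'I_k -> H,
           lin_indep v /\ forall i, W (v i) = mu%:C *: v i) <->
        (exists s : 'I_k -> nat,
           injective s /\ forall i, (0 < s i)%N /\ a (s i) = mu)].

End Operators.

Variant criterion := ABS | NOR.

Section Tractability.
Variable R : realType.
Implicit Types (cri : criterion) (lam : nat -> nat -> R).

Definition CRI cri (a : nat -> R) : R :=
  match cri with ABS => 1 | NOR => a 1%N end.

Definition nat_min (P : set nat) : nat :=
  xget 0%N [set n | P n /\ forall m, P m -> (n <= m)%N].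

Definition info_complexity cri (a : nat -> R) (eps : R) : nat :=
  nat_min [set n | a n.+1 <= eps ^+ 2 * CRI cri a].

(* In a family [lam], the sequence [lam d] belongs to the d-th operator; only
   [d >= 1] is used. *)
Definition EXP_PT cri lam : Prop :=
  exists C p q : R, [/\ 0 <= C, 0 <= p, 0 <= q &
    forall (d : nat) (eps : R), (0 < d)%N -> 0 < eps ->
      (info_complexity cri (lam d) eps)%:R <=
        C * d%:R `^ q * (1 + ln (Num.max 1 eps^-1)) `^ p].

Definition EXP_SPT_with cri lam (p : R) : Prop :=
  exists C : R, 0 <= C /\
    forall (d : nat) (eps : R), (0 < d)%N -> 0 < eps ->
      (info_complexity cri (lam d) eps)%:R <=
        C * (1 + ln (Num.max 1 eps^-1)) `^ p.

Definition EXP_SPT cri lam : Prop :=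
  exists p : R, 0 <= p /\ EXP_SPT_with cri lam p.

Definition EXP_SPT_exponent cri lam : R :=
  inf [set p | 0 <= p /\ EXP_SPT_with cri lam p].

Definition cond_sup cri lam (tau1 tau2 tau3 C : R) : \bar R :=
  ereal_sup
    [set ((d%:R `^ (- tau1))%:E *
          \sum_(`|Num.ceil (C * d%:R `^ tau3)|%N <= j <oo)
            ((lam d j / CRI cri (lam d)) `^ (j%:R `^ (- tau2)))%:E)%E
    | d in [set d : nat | (0 < d)%N]].

Definition cond cri lam (tau1 tau2 tau3 C : R) : Prop :=
  (cond_sup cri lam tau1 tau2 tau3 C < +oo)%E.

Definition complexity_bound cri lam (tau1 tau2 tau3 C : R) : Prop :=
  forall (eps : R) (d : nat), 0 < eps -> (0 < d)%N ->
    (info_complexity cri (lam d) eps)%:Z <=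
      Num.floor (fine (cond_sup cri lam tau1 tau2 tau3 C) * expR 1
                 * d%:R `^ tau1)
      + Num.ceil (C * d%:R `^ tau3)
      + Num.ceil (Num.max 0 (2 * ln eps^-1) `^ tau2^-1).

End Tractability.

(* Main.v *)
Require Import Defs.
From HB Require Import structures.
From mathcomp Require Import all_boot all_order all_algebra.
From mathcomp Require Import complex.
From mathcomp Require Import all_classical all_reals all_analysis.
From mathcomp Require Import ring lra.
Import Order.TTheory GRing.Theory Num.Theory.
Import numFieldNormedType.Exports.
Local Open Scope classical_set_scope.
Local Open Scope ring_scope.

(** Write b_j for lambda_(d,j) / CRI_d.  If the sum in the condition is at most
    M d^tau1, at most M e d^tau1 of its terms exceed 1/e, so every window of
    floor (M e d^tau1) + 1 indices contains a j with b_j <= exp (- j^tau2); a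
    window starting at the larger of the two ceilings gives the complexity bound.

    Conversely, a bound n(eps) <= C d^q (1 + ln (1/eps))^p can be inverted to
    b_j <= exp (2 - 2 (j/D)^(1/p')) for p' > p and j >= D = (C + 1) d^q.  Raised
    to the power j^(-tau2) with tau2 < 1/p', this is O (D^s j^(-2)) for some s.
    Hence all p above the exponent arise as 1/tau2.  The inversion needs
    lambda_(d,j) -> 0, which is where compactness of S_d enters. *)

(** * Inner product identities in a complex Hilbert space *)

Lemma conj_realC (R : realType) (x : R) : Num.conj (x%:C)%C = (x%:C)%C.
Proof. exact: conjc_real. Qed.

Section HilbertSpace.
Variables (R : realType) (H : hilbertType R).
Implicit Types (x y z : H) (a : R[i]).
Local Open Scope complex_scope.

Lemma inner0l z : inner 0 z = 0.
Proof.
have := inner_linear 1 0 0 z.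
by rewrite scale1r addr0 mul1r => /(congr1 (fun t => t - inner 0 z)); rewrite subrr addrK.
Qed.

Lemma innerDl x y z : inner (x + y) z = inner x z + inner y z.
Proof. by have := inner_linear 1 x y z; rewrite scale1r mul1r. Qed.

Lemma innerZl a x z : inner (a *: x) z = a * inner x z.
Proof. by have := inner_linear a x 0 z; rewrite inner0l !addr0. Qed.

Lemma inner_suml (I : Type) (r : seq I) (P : pred I) (F : I -> H) z :
  inner (\sum_(i <- r | P i) F i) z = \sum_(i <- r | P i) inner (F i) z.
Proof.
elim/big_rec2 : _ => [|i y1 y2 _ <-]; first exact: inner0l.
exact: innerDl.
Qed.

Lemma innerZr a x z : inner x (a *: z) = a^* * inner x z.
Proof. by rewrite inner_conj innerZl rmorphM /= -inner_conj. Qed.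

Lemma inner_eq0_sym {x y} : inner x y = 0 -> inner y x = 0.
Proof. by move=> xy0; rewrite inner_conj xy0 conjc0. Qed.

Lemma normB_orth x y : inner x y = 0 -> `|x - y| ^+ 2 = `|x| ^+ 2 + `|y| ^+ 2.
Proof.
move=> xy0; rewrite inner_norm -scaleN1r innerDl innerZl.
rewrite inner_conj innerDl innerZl (inner_eq0_sym xy0) mulr0 addr0 -inner_conj.
rewrite [inner y _]inner_conj innerDl innerZl xy0 add0r rmorphM rmorphN rmorph1 /=.
by rewrite -inner_conj mulN1r mulN1r opprK !inner_norm.
Qed.

Lemma inner_ext x y : (forall u, inner u x = inner u y) -> x = y.
Proof.
move=> xy; apply/eqP; rewrite -subr_eq0 -normr_eq0 -(sqrf_eq0 `|_|).
rewrite inner_norm inner_conj -scaleN1r innerDl innerZl.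
by rewrite (inner_conj _ x) (inner_conj _ y) xy mulN1r subrr conjc0.
Qed.

Lemma exists_normalizing_scalar x : x != 0 -> exists2 a, a != 0 & `|a *: x| = 1.
Proof.
move=> x0; exists (`|x|^-1); first by rewrite invr_eq0 normr_eq0.
by rewrite normrZ normfV normr_id mulVf// normr_eq0.
Qed.

End HilbertSpace.

(** * Eigenvectors of [W], and compactness forcing arbitrarily small eigenvalues *)

Section CompactOperator.
Variables (R : realType) (H G : hilbertType R) (S : {linear H -> G}).
Variables (Sadj : G -> H).
Hypothesis adjS : adjoint_of S Sadj.
Local Open Scope complex_scope.
Let W (f : H) : H := Sadj (S f).

Lemma inner_eigen (mu : R) (v w : H) :
  W w = mu%:C *: w -> inner (S v) (S w) = mu%:C * inner v w.
Proof. by move=> Ww; rewrite adjS -/(W w) Ww innerZr conj_realC. Qed.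

Lemma inner_eigenl (mu : R) (v w : H) :
  W v = mu%:C *: v -> inner (S v) (S w) = mu%:C * inner v w.
Proof.
move=> Wv; rewrite inner_conj (inner_eigen _ _ _ Wv) rmorphM.
by congr (_ * _); [exact: conjc_real | rewrite [RHS]inner_conj].
Qed.

(** The inner product of [S v] and [S w] can be computed from either eigenvector; comparing the two
    values gives [(mu - nu) * inner v w = 0]. *)
Lemma eigen_orth (mu nu : R) (v w : H) : mu != nu ->
  W v = mu%:C *: v -> W w = nu%:C *: w -> inner v w = 0.
Proof.
move=> munu Wv Ww.
have := inner_eigenl _ _ w Wv; rewrite (inner_eigen _ _ _ Ww) => /eqP.
rewrite -subr_eq0 -mulrBl mulf_eq0 -rmorphB /= => /orP[|/eqP//].
by rewrite fmorph_eq0 subr_eq0 eq_sym (negbTE munu).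
Qed.

(** [Sadj] is a bare map tied to [S] by the adjoint identity, so a linear combination is passed
    through [W] by testing against every [u] and using the linearity of [S]. *)
Lemma eigen_sum (mu : R) (k : nat) (v : 'I_k -> H) (c : 'I_k -> R[i])  :
  (forall i, W (v i) = mu%:C *: v i) ->
  W (\sum_i c i *: v i) = mu%:C *: (\sum_i c i *: v i).
Proof.
move=> Wv; apply: inner_ext => u; rewrite /W -adjS inner_conj [in RHS]inner_conj.
congr (_^*); rewrite innerZl linear_sum !inner_suml mulr_sumr.
apply: eq_bigr => i _; rewrite linearZ /= !innerZl mulrCA; congr (_ * _).
exact: inner_eigenl.
Qed.

Variable a : nat -> R.
Hypothesis a_eig : eigenvalue_seq W a.

(** Orthogonality is asked only against earlier entries, so appending a vector adds conditions on
    that vector alone. Position [j] goes with [a j.+1] because eigenvalues are numbered from 1. *)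
Definition eigen_orthonormal (s : seq H) : Prop :=
  forall j, (j < size s)%N ->
    [/\ W (nth 0 s j) = (a j.+1)%:C *: nth 0 s j, `|nth 0 s j| = 1
      & forall i, (i < j)%N -> inner (nth 0 s j) (nth 0 s i) = 0].

(* If the value a_(k+1) occurs m times among a_1, ..., a_(k+1), its eigenspace
   contains m independent vectors, and some nonzero combination of them is
   orthogonal to the m - 1 vectors of that eigenspace already chosen. *)
Lemma eigen_orthonormal_extend (s : seq H) :
  0 < a (size s).+1 -> eigen_orthonormal s ->
  exists x : H, eigen_orthonormal (rcons s x).
Proof.
set k := size s; set mu := a k.+1 => mu0 sP.
pose idx := [seq i <- iota 0 k | a i.+1 == mu].
have idxP i : i \in idx -> (i < k)%N /\ a i.+1 = mu.
  by rewrite mem_filter mem_iota add0n => /andP[/eqP].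
have uidx : uniq (rcons idx k).
  rewrite rcons_uniq filter_uniq ?iota_uniq// andbT.
  by apply/negP => /idxP[]; rewrite ltnn.
pose m := size idx.
have [w [wi Ww]] : exists v : 'I_m.+1 -> H,
    lin_indep v /\ forall i, W (v i) = mu%:C *: v i.
  have [_ _ /(_ mu mu0 m.+1)[_]] := a_eig; apply.
  exists (fun i => (nth 0%N (rcons idx k) i).+1); split.
    move=> i j /succn_inj/eqP; rewrite nth_uniq// ?size_rcons//.
    by move=> /eqP/val_inj.
  move=> i; split=> //.
  have : nth 0%N (rcons idx k) i \in rcons idx k.
    by rewrite mem_nth// size_rcons.
  by rewrite mem_rcons inE => /orP[/eqP->//|/idxP[]].
(* A left kernel vector of [A] holds the coefficients of a combination of the [w i] orthogonal to
   the [m] earlier eigenvectors for [mu]; with [m.+1] rows and [m] columns a nonzero one exists. *)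
pose A : 'M[R[i]]_(m.+1, m) := \matrix_(i, j) inner (w i) (nth 0 s (nth 0%N idx j)).
have : kermx A != 0.
  rewrite kermx_eq0 /row_free neq_ltn; apply/orP; left.
  by rewrite ltnS rank_leq_col.
case/rowV0Pn => u /sub_kermxP uA u0.
pose y := \sum_i u 0 i *: w i.
have y0 : y != 0.
  apply: contraNneq u0 => /(wi (fun i => u 0 i)) u0.
  by apply/eqP/rowP => i; rewrite u0 mxE.
have Wy : W y = mu%:C *: y by apply: eigen_sum.
have yorth i : (i < k)%N -> inner y (nth 0 s i) = 0.
  move=> ik; have [ai|ai] := eqVneq (a i.+1) mu; last first.
    rewrite eq_sym in ai; apply: eigen_orth ai Wy _.
    by have [] := sP i ik.
  have iidx : i \in idx by rewrite mem_filter ai eqxx mem_iota add0n.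
  have /rowP/(_ (Ordinal (etrans (index_mem i idx) iidx))) := uA.
  rewrite !mxE /y inner_suml => uAi; rewrite -[RHS]uAi.
  by apply: eq_bigr => l _; rewrite innerZl !mxE /= nth_index.
have [b b0 yb] := exists_normalizing_scalar _ _ y y0.
exists (b *: y) => j; rewrite size_rcons ltnS leq_eqVlt => /orP[/eqP->|jk].
  rewrite nth_rcons ltnn eqxx; split=> //.
    have := eigen_sum mu 1 (fun=> y) (fun=> b) (fun=> Wy).
    by rewrite big_ord1.
  by move=> i ik; rewrite nth_rcons ik innerZl yorth// mulr0.
rewrite nth_rcons jk; have [h1 h2 h3] := sP j jk; split=> // i ij.
by rewrite nth_rcons (ltn_trans ij jk) h3.
Qed.

Hypothesis compactS : compact_op S.

(* Otherwise an infinite orthonormal sequence of eigenvectors with eigenvalues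
   at least [c] is mapped by [S] to a uniformly separated sequence. *)
Lemma eigenvalue_seq_cvg0 (c : R) : 0 < c ->
  exists2 n, (0 < n)%N & a n <= c.
Proof.
move=> c0; apply: contrapT => Nac.
have ac n : (0 < n)%N -> c < a n.
  by move=> n0; rewrite ltNge; apply/negP => anc; apply: Nac; exists n.
(* On lists that are not orthonormal the extension takes the default value 0, which makes [g] total
   so that it can be iterated. *)
have /choice[g gP] : forall s, exists x, eigen_orthonormal s ->
    eigen_orthonormal (rcons s x).
  move=> s; have [sP|nsP] := pselect (eigen_orthonormal s); last by exists 0.
  have [x xP] := eigen_orthonormal_extend s (lt_trans c0 (ac _ (ltn0Sn _))) sP.
  by exists x.
pose f := fix f n : seq H := if n is n'.+1 then rcons (f n') (g (f n')) else [::].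
pose v n := g (f n).
have sf n : size (f n) = n by elim: n => //= n IH; rewrite size_rcons IH.
have fP n : eigen_orthonormal (f n) by elim: n => //= n IH; exact: gP.
have nf n i : (i < n)%N -> nth 0 (f n) i = v i.
  elim: n => // n IH; rewrite ltnS leq_eqVlt /= nth_rcons sf => /orP[/eqP->|ni].
    by rewrite ltnn eqxx.
  by rewrite ni IH.
have vP n : [/\ W (v n) = (a n.+1)%:C *: v n, `|v n| = 1
      & forall i, (i < n)%N -> inner (v n) (v i) = 0].
  have := fP n.+1 n; rewrite sf ltnSn nf// => /(_ isT)[h1 h2 h3]; split=> // i ni.
  by rewrite -(nf n.+1 i) ?h3// ltnS ltnW.
have Sv2 n : `|S (v n)| ^+ 2 = (a n.+1)%:C.
  have [Wv v1 _] := vP n.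
  by rewrite inner_norm (inner_eigen _ _ _ Wv) -inner_norm v1 expr1n mulr1.
(* The images are orthogonal as well, so the squared distance is [a n.+1 + a i.+1], and both
   summands exceed [c]. *)
have sep n i : (i < n)%N -> c%:C < `|S (v n) - S (v i)| ^+ 2.
  move=> ni; have [_ _ /(_ i ni) vni] := vP n; have [Wi _ _] := vP i.
  rewrite normB_orth ?(inner_eigen _ _ _ Wi) ?vni ?mulr0// !Sv2 -rmorphD ltcR.
  by rewrite ltr_wpDr ?ac// ltW// (lt_trans c0)// ac.
have := compactS; rewrite /compact_op precompactE => /(_ ((S \o v) @ \oo)).
case.
  exists 0%N => // n _ /=; apply: subset_closure; exists (v n) => //=.
  by have [_ -> _] := vP n.
move=> p [_ clp].
(* With this radius, two points of the ball around the cluster point [p] have squared distance below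
   [c], against [sep]. *)
pose r : R[i] := (Num.sqrt c / 2)%:C.
have r0 : 0 < r by rewrite ltcR divr_gt0// sqrtr_gt0.
have pick N : exists2 n, (N <= n)%N & ball p r (S (v n)).
  have [] := clp [set z | exists2 n, (N <= n)%N & z = S (v n)] (ball p r).
  - by exists N => // n /= Nn; exists n.
  - exact: nbhsx_ballx.
  by move=> z [[n Nn ->] pz]; exists n.
have [i _ pi_] := pick 0%N; have [n ni pn] := pick i.+1.
have near : `|S (v n) - S (v i)| < r + r.
  have := ball_triangle (ball_sym pn) pi_.
  by rewrite -ball_normE.
have rr : (r + r) ^+ 2 = c%:C.
  rewrite -rmorphD -rmorphXn /= -splitr sqr_sqrtr// ltW//.
have near2 : `|S (v n) - S (v i)| ^+ 2 < (r + r) ^+ 2.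
  by rewrite ltrXn2r// nnegrE addr_ge0// ltW.
by have := lt_trans (sep n i ni) near2; rewrite rr ltxx.
Qed.

End CompactOperator.

(** * Least elements and the information complexity of one eigenvalue sequence *)

(** The witness [P n] guarantees that a least element exists, so [xget] does not fall back on its
    default 0. *)
Lemma nat_minP (P : set nat) (n : nat) : P n ->
  P (nat_min P) /\ (nat_min P <= n)%N.
Proof.
move=> Pn.
have exP : exists k, `[< P k >] by exists n; exact/asboolP.
have least : exists k, P k /\ forall m, P m -> (k <= m)%N.
  exists (ex_minn exP); case: ex_minnP => k /asboolP Pk kmin; split=> // m Pm.
  by apply: kmin; exact/asboolP.
by have [? min] := xgetPex 0%N least; split=> //; exact: min.
Qed.

Section InformationComplexity.
Variables (R : realType) (cri : criterion) (a : nat -> R).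
Hypothesis a_ge0 : forall j, (0 < j)%N -> 0 <= a j.
Hypothesis a_dec : forall j, (0 < j)%N -> a j.+1 <= a j.

Lemma eigenvalue_seq_nonincr i j : (0 < i)%N -> (i <= j)%N -> a j <= a i.
Proof.
move=> i0 /subnKC <-; elim: (j - i)%N => [|k IH]; first by rewrite addn0.
by rewrite addnS (le_trans _ IH)// a_dec// addn_gt0 i0.
Qed.

Lemma CRI_ge0 : 0 <= CRI cri a.
Proof. by case: cri => /=; rewrite ?ler01 ?a_ge0. Qed.

Lemma normalized_ge0 j : (0 < j)%N -> 0 <= a j / CRI cri a.
Proof. by move=> j0; rewrite divr_ge0 ?a_ge0 ?CRI_ge0. Qed.

Lemma normalized_nonincr i j : (0 < i)%N -> (i <= j)%N ->
  a j / CRI cri a <= a i / CRI cri a.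
Proof.
by move=> i0 ij; rewrite ler_wpM2r ?invr_ge0 ?CRI_ge0// eigenvalue_seq_nonincr.
Qed.

(* In the degenerate case [CRI cri a = 0] every eigenvalue vanishes, and both
   sides hold because [x / 0 = 0]. *)
Lemma le_CRI_normalized (e : R) n : (0 < n)%N -> 0 <= e ->
  (a n <= e * CRI cri a) = (a n / CRI cri a <= e).
Proof.
move=> n0 e0; have [CRI0|CRI0] := eqVneq (CRI cri a) 0; last first.
  by rewrite ler_pdivrMr// lt_neqAle eq_sym CRI0 CRI_ge0.
rewrite CRI0 mulr0 invr0 mulr0 e0; move: CRI0; case: cri => /= [/eqP|<-].
  by rewrite oner_eq0.
exact: eigenvalue_seq_nonincr.
Qed.

(** The inequality is strict because [info_complexity] tests the eigenvalue of index [n.+1] for the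
    candidate [n]. *)
Lemma info_complexity_lt (eps : R) n : (0 < n)%N ->
  a n / CRI cri a <= eps ^+ 2 -> (info_complexity cri a eps < n)%N.
Proof.
case: n => // n _ an; rewrite ltnS; apply: (nat_minP _ n _).2 => /=.
by rewrite le_CRI_normalized// sqr_ge0.
Qed.

(** Arbitrarily small eigenvalues make the set under the minimum nonempty. If [CRI cri a = 0], the
    quotient is 0 by convention. *)
Lemma info_complexity_attained (eps : R) : 0 < eps ->
  (forall c, 0 < c -> exists2 n, (0 < n)%N & a n <= c) ->
  a (info_complexity cri a eps).+1 / CRI cri a <= eps ^+ 2.
Proof.
move=> eps0 a_cvg0; rewrite -le_CRI_normalized ?sqr_ge0//.
have [CRI0|CRI0] := eqVneq (CRI cri a) 0.
  rewrite le_CRI_normalized ?sqr_ge0// CRI0 invr0 mulr0; exact: sqr_ge0.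
have [|[//|n] _ an] := a_cvg0 (eps ^+ 2 * CRI cri a).
  by rewrite mulr_gt0 ?exprn_gt0// lt_neqAle eq_sym CRI0 CRI_ge0.
exact: (nat_minP [set n | a n.+1 <= eps ^+ 2 * CRI cri a] n an).1.
Qed.

End InformationComplexity.

(** * Elementary real estimates *)

Section RealEstimates.
Variable R : realType.
Implicit Types (b y m D g t : R) (j n : nat).

(** This is [expR (- u) <= u^-1] at [u = y / m], raised to the power [m]. *)
Lemma expRN_le_powR y m : 0 < y -> 0 < m -> expR (- y) <= (m / y) `^ m.
Proof.
move=> y0 m0.
have -> : expR (- y) = (expR (- (y / m))) `^ m.
  by rewrite -expRM mulNr divfK// gt_eqF.
apply: ge0_ler_powR; rewrite ?nnegrE ?expR_ge0 ?divr_ge0 ?(ltW m0) ?(ltW y0)//.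
rewrite -[leRHS]invrK invf_div expRN lef_pV2 ?posrE ?expR_gt0 ?divr_gt0//.
by rewrite (le_trans _ (expR_ge1Dx _))// lerDr ler01.
Qed.

(** Telescoping: [1 / (i + 2)^2] is at most [1 / (i + 1) - 1 / (i + 2)]. *)
Lemma sum_inv_sqr_le2 n k : (0 < k)%N ->
  \sum_(k <= j < n) (j%:R ^+ 2)^-1 <= 2 :> R.
Proof.
move=> k0.
have main i : \sum_(1 <= j < i.+2) (j%:R ^+ 2)^-1 <= 2 - i.+1%:R^-1 :> R.
  elim: i => [|i IH]; first by rewrite big_nat1 expr1n invr1; lra.
  rewrite big_nat_recr//=; apply: le_trans (lerD IH (lexx _)) _.
  have -> : (i.+2%:R ^+ 2)^-1 = i.+2%:R^-1 * i.+2%:R^-1 :> R.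
    by rewrite expr2 invfM.
  have i1 : (0 : R) < i.+1%:R by rewrite ltr0n.
  have i2 : (0 : R) < i.+2%:R by rewrite ltr0n.
  have le12 : i.+2%:R^-1 * i.+2%:R^-1 <= i.+1%:R^-1 * i.+2%:R^-1 :> R.
    by rewrite ler_pM2r ?invr_gt0// lef_pV2 ?posrE// ler_nat.
  have e : i.+1%:R^-1 - i.+2%:R^-1 = i.+1%:R^-1 * i.+2%:R^-1 :> R.
    rewrite -[i.+2%:R]natr1; field.
    by have ri := ler0n R i; rewrite !lt0r_neq0//; lra.
  by rewrite (le_trans (lerD (lexx _) le12))// -e addrA subrK.
have [nk|kn] := leqP n k; first by rewrite big_geq.
case: n kn => [|[|n]] kn; rewrite ?ltn0// in kn *.
  by move: kn; rewrite ltnS leqNgt k0.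
have : \sum_(k <= j < n.+2) (j%:R ^+ 2)^-1
    <= \sum_(1 <= j < n.+2) (j%:R ^+ 2)^-1 :> R.
  rewrite [leRHS](@big_cat_nat _ _ _ k)//=; last exact: ltnW.
  by rewrite lerDr sumr_ge0// => i _; rewrite invr_ge0 sqr_ge0.
move=> /le_trans; apply; apply: le_trans (main n) _.
by rewrite gerBl invr_ge0 ler0n.
Qed.

(* With [y = 2 j^(g - t) / D^g], the term is at most [e^2 exp(-y)], and
   [exp(-y) <= (m / y)^m] with [m = 2 / (g - t)] produces the summable [j^-2]. *)
Lemma decay_term_le b D g t j : (0 < j)%N -> 0 < D -> 0 < t -> t < g ->
  0 <= b -> b <= expR (2 - 2 * (j%:R / D) `^ g) ->
  b `^ (j%:R `^ (- t)) <=
    expR 2 * (2 / (g - t) / 2) `^ (2 / (g - t)) * D `^ (g * (2 / (g - t)))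
      * (j%:R ^+ 2)^-1.
Proof.
move=> j0 D0 t0 tg b0 bj.
have J0 : (0 : R) < j%:R by rewrite ltr0n.
have J1 : (1 : R) <= j%:R by rewrite ler1n.
set m := 2 / (g - t); set s := j%:R `^ (- t).
have m0 : 0 < m by rewrite divr_gt0// subr_gt0.
have mE : (g - t) * m = 2 by rewrite mulrC divfK// gt_eqF// subr_gt0.
clearbody m.
have s0 : 0 < s by exact: powR_gt0.
have s1 : s <= 1.
  by rewrite -(powRr0 (j%:R : R)) ler_powR// oppr_le0 ltW.
have g0 : 0 < g by exact: lt_trans tg.
pose y := 2 * (j%:R `^ (g - t) * D `^ (- g)).
have y0 : 0 < y by rewrite !mulr_gt0// powR_gt0.
have ys : s * (2 * (j%:R / D) `^ g) = y.
  rewrite /y powRM ?invr_ge0 ?ltW// -(powR_inv1 (ltW D0)) -powRrM mulN1r.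
  rewrite mulrCA; congr (2 * _); rewrite mulrA; congr (_ * _).
  by rewrite addrC powRD// (gt_eqF J0) implybT.
(* Raising to the power [s] turns the factor [expR 2] into [expR (2 * s)], and [s <= 1] bounds it
   independently of [j]. *)
have step1 : b `^ s <= expR 2 * expR (- y).
  apply: (@le_trans _ _ (expR (2 - 2 * (j%:R / D) `^ g) `^ s)).
    by apply: ge0_ler_powR; rewrite ?nnegrE ?expR_ge0// (ltW s0).
  rewrite -expRM -expRD ler_expR mulrBl [X in _ - X]mulrC ys.
  by rewrite lerD2r ler_piMr.
apply: (le_trans step1); rewrite -!mulrA ler_pM2l ?expR_gt0//.
apply: le_trans (expRN_le_powR _ _ y0 m0) _.
have -> : m / y = m / 2 * (D `^ g * j%:R `^ (- (g - t))).
  by rewrite /y !invfM -(powRN j%:R) -(powRN D) opprK [D `^ _ * _]mulrC -[RHS]mulrA.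
rewrite powRM ?mulr_ge0 ?powR_ge0 ?invr_ge0 ?(ltW m0)//.
by rewrite powRM ?powR_ge0// -!powRrM mulNr mE powRN powR_mulrn// ltW.
Qed.

End RealEstimates.

(** * Passing between the summability condition and bounds on the complexity *)

Section ComplexityBound.
Variables (R : realType) (cri : criterion) (lam : nat -> nat -> R).
Implicit Types (tau C p q r : R) (d j n : nat).

Definition cond_start tau C d : nat := `|Num.ceil (C * d%:R `^ tau)|%N.

Definition cond_term tau d j : R :=
  (lam d j / CRI cri (lam d)) `^ (j%:R `^ (- tau)).

Lemma cond_start_gt0 tau C d : (0 < d)%N -> 0 < C -> (0 < cond_start tau C d)%N.
Proof.
move=> d0 C0; rewrite absz_gt0 gt_eqF// ceil_gt0 mulr_gt0//.
by rewrite powR_gt0// ltr0n.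
Qed.

(** Partial sums of nonnegative terms stay below the series, hence below the supremum. [fine]
    returns its true value because the supremum lies between a real number and [+oo]. *)
Lemma cond_partial_sum_le tau1 tau2 tau3 C d n :
  cond cri lam tau1 tau2 tau3 C -> (0 < d)%N ->
  \sum_(cond_start tau3 C d <= j < n) cond_term tau2 d j <=
    fine (cond_sup cri lam tau1 tau2 tau3 C) * d%:R `^ tau1.
Proof.
move=> lam_cond d0; set M := cond_sup _ _ _ _ _ _.
have D0 : 0 < d%:R `^ (- tau1) by rewrite powR_gt0// ltr0n.
have leM : ((d%:R `^ (- tau1) *
    \sum_(cond_start tau3 C d <= j < n) cond_term tau2 d j)%:E <= M)%E.
  rewrite EFinM -sumEFin; apply: le_trans; last first.
    by apply: ereal_sup_ubound; exists d.
  rewrite lee_pmul2l//; apply: nneseries_lim_ge => j _ _.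
  by rewrite lee_fin powR_ge0.
have Mfin : M \is a fin_num.
  by rewrite fin_numE -ltey -ltNye lam_cond (lt_le_trans _ leM)// ltNyr.
move: leM; rewrite -(fineK Mfin) lee_fin powRN ler_pdivrMl ?powR_gt0 ?ltr0n//.
by rewrite mulrC.
Qed.

Lemma cond_of_partial_sum tau1 tau2 tau3 C B :
  (forall d n, (0 < d)%N ->
    \sum_(cond_start tau3 C d <= j < n) cond_term tau2 d j <= B * d%:R `^ tau1) ->
  cond cri lam tau1 tau2 tau3 C.
Proof.
move=> leB; apply: (@le_lt_trans _ _ B%:E); last exact: ltry.
apply: ge_ereal_sup => _ [d /= d0 <-].
have D0 : 0 < d%:R `^ tau1 by rewrite powR_gt0// ltr0n.
rewrite powRN lee_pdivrMl// -EFinM.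
apply: lime_le.
  by apply: is_cvg_nneseries => j _ _; rewrite lee_fin powR_ge0.
by apply: nearW => n; rewrite sumEFin lee_fin [leRHS]mulrC; exact: leB.
Qed.

Hypothesis lam_ge0 : forall d j, (0 < d)%N -> (0 < j)%N -> 0 <= lam d j.
Hypothesis lam_dec : forall d j, (0 < d)%N -> (0 < j)%N -> lam d j.+1 <= lam d j.

(** Raising the hypothesis to the power [j^tau2] cancels the exponent [j^(-tau2)]. *)
Lemma cond_term_expR tau2 d j : (0 < d)%N -> (0 < j)%N ->
  cond_term tau2 d j <= expR (- 1) ->
  lam d j / CRI cri (lam d) <= expR (- (j%:R `^ tau2)).
Proof.
move=> d0 j0 le_e.
have b0 := normalized_ge0 _ cri _ (lam_ge0 d ^~ d0) j j0.
have e : j%:R `^ (- tau2) * j%:R `^ tau2 = 1 :> R.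
  by rewrite powRN mulVf// gt_eqF// powR_gt0// ltr0n.
rewrite -[leLHS](powRr1 b0) -[X in _ `^ X <= _]e powRrM -[X in expR X]mulN1r expRM.
by rewrite ge0_ler_powR ?nnegrE ?powR_ge0 ?expR_ge0.
Qed.

Lemma cond_complexity_bound tau1 tau2 tau3 C : 0 < tau2 -> 0 < C ->
  cond cri lam tau1 tau2 tau3 C -> complexity_bound cri lam tau1 tau2 tau3 C.
Proof.
move=> tau20 C0 lam_cond eps d eps0 d0.
set M := fine _; set Lt := Num.max 0 _ `^ _.
have D0 : 0 < d%:R `^ tau1 :> R by rewrite powR_gt0// ltr0n.
have sumM n := cond_partial_sum_le tau1 tau2 tau3 C d n lam_cond d0.
have MD0 : 0 <= M * d%:R `^ tau1.
  by apply: le_trans (sumM 0%N); rewrite big_geq.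
pose F := `|Num.floor (M * expR 1 * d%:R `^ tau1)|%N.
have FE : F%:Z = Num.floor (M * expR 1 * d%:R `^ tau1).
  by rewrite gez0_abs// floor_ge0 mulrAC mulr_ge0// expR_ge0.
pose j0 := cond_start tau3 C d.
have j0E : j0%:Z = Num.ceil (C * d%:R `^ tau3).
  rewrite gez0_abs// ceil_ge0 (lt_le_trans (ltrN10 R))// mulr_ge0 ?powR_ge0//.
  exact: ltW.
pose k := `|Num.ceil Lt|%N.
have kE : k%:Z = Num.ceil Lt.
  by rewrite gez0_abs// ceil_ge0 (lt_le_trans (ltrN10 R))// powR_ge0.
(* Starting beyond [j0] keeps the window inside the sum; starting beyond [k] ensures [Lt <= j] for
   the index found. *)
pose K := maxn j0 k.
have [j [Kj jKF le_e]] : exists j, [/\ (K <= j)%N, (j <= K + F)%N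
    & cond_term tau2 d j <= expR (- 1)].
  apply: contrapT => gt_e.
  have {}gt_e j : (K <= j < K + F.+1)%N -> expR (- 1) <= cond_term tau2 d j.
    move=> /andP[Kj]; rewrite addnS ltnS => jKF; rewrite leNgt; apply/negP => h.
    by apply: gt_e; exists j; split=> //; exact: ltW.
  have := sumM (K + F.+1)%N; rewrite (@big_cat_nat _ _ _ K)/=; first last.
  - exact: leq_addr.
  - exact: leq_maxl.
  apply/negP; rewrite -ltNge.
  (* The window has [F.+1] terms and [F.+1 > M * expR 1 * d^tau1], so terms of size at least
     [expR (- 1)] would already exceed the total. *)
  apply: (@lt_le_trans _ _ (\sum_(K <= j < K + F.+1) expR (- 1))); last first.
    rewrite (@le_trans _ _ (\sum_(K <= j < K + F.+1) cond_term tau2 d j))//.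
      by rewrite ler_sum_nat.
    by rewrite lerDr sumr_ge0// => j _; exact: powR_ge0.
  rewrite sumr_const_nat addnC addnK expRN -[ltRHS]mulr_natl ltr_pdivlMr ?expR_gt0//.
  rewrite mulrAC; apply: (lt_le_trans (floorD1_gt _)).
  by rewrite -FE -natr1 intrD.
have jpos : (0 < j)%N.
  by apply: leq_trans Kj; rewrite leq_max cond_start_gt0.
have bj := cond_term_expR tau2 d j d0 jpos le_e.
have : (info_complexity cri (lam d) eps < j)%N.
  apply: info_complexity_lt => //.
  - by move=> i; exact: lam_ge0.
  - by move=> i; exact: lam_dec.
  apply: le_trans bj _.
  have -> : eps ^+ 2 = expR (- (2 * ln eps^-1)).
    by rewrite lnV ?posrE// mulrN opprK expRM_natl lnK.
  rewrite ler_expR lerN2.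
  have Ltj : Lt <= j%:R.
    rewrite (le_trans (ceil_ge _))// -kE -[_%:~R]/(k%:R) ler_nat.
    by rewrite (leq_trans _ Kj)// leq_maxr.
  have : Lt `^ tau2 <= j%:R `^ tau2.
    by rewrite ge0_ler_powR ?nnegrE ?powR_ge0 ?(ltW tau20).
  apply: le_trans; rewrite /Lt -powRrM mulVf ?gt_eqF// powRr1 ?le_max ?lexx//.
  by rewrite orbT.
move=> infoj; rewrite -FE -j0E -kE -!PoszD lez_nat.
rewrite (leq_trans (ltnW infoj))// (leq_trans jKF)// addnC -addnA leq_add2l.
by rewrite geq_max leq_addr leq_addl.
Qed.

(** Each summand of the complexity bound is at most a constant times [Q * P], since both factors are
    at least 1. Each ceiling costs one extra unit, hence [C + 1] and the other [+ 1] in the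
    constant. *)
Lemma cond_info_complexity_le tau1 tau2 tau3 C :
  0 <= tau1 -> 0 < tau2 -> 0 <= tau3 -> 0 < C ->
  cond cri lam tau1 tau2 tau3 C ->
  exists2 B : R, 0 <= B & forall d (eps : R), (0 < d)%N -> 0 < eps ->
    (info_complexity cri (lam d) eps)%:R <=
      B * d%:R `^ (Num.max tau1 tau3)
        * (1 + ln (Num.max 1 eps^-1)) `^ tau2^-1.
Proof.
move=> tau10 tau20 tau30 C0 lam_cond.
have bound := cond_complexity_bound tau1 tau2 tau3 C tau20 C0 lam_cond.
move: bound; rewrite /complexity_bound; set M := fine _ => bound.
have M0 : 0 <= M.
  have := cond_partial_sum_le tau1 tau2 tau3 C 1 0 lam_cond isT.
  by rewrite big_geq// powR1 mulr1.
have E0 : 0 <= M * expR 1 by rewrite mulr_ge0 ?expR_ge0.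
have T0 := powR_ge0 (2 : R) tau2^-1.
exists (M * expR 1 + (C + 1) + (2 `^ tau2^-1 + 1)); first by lra.
move=> d eps d0 eps0.
have d1 : (1 : R) <= d%:R by rewrite ler1n.
set Q := d%:R `^ Num.max _ _.
have Q1 : 1 <= Q.
  by rewrite -(powRr0 (d%:R : R)) ler_powR// le_max tau10.
have Qt1 : d%:R `^ tau1 <= Q by rewrite ler_powR// le_max lexx.
have Qt3 : d%:R `^ tau3 <= Q by rewrite ler_powR// le_max lexx orbT.
set L := ln _.
have LE : Num.max 0 (2 * ln eps^-1) = 2 * L.
  rewrite /L; case: (leP 1 eps^-1) => h.
    by rewrite max_r// mulr_ge0// ln_ge0.
  by rewrite ln1 mulr0 max_l// pmulr_rle0// ln_le0// ltW.
have L0 : 0 <= L.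
  by rewrite -(pmulr_rge0 L (ltr0n R 2)) -LE le_max lexx.
set P := (1 + L) `^ _.
have P1 : 1 <= P.
  rewrite -(powRr0 (1 + L)) ler_powR ?invr_ge0 ?(ltW tau20)//.
  by rewrite lerDl.
have LP : (2 * L) `^ tau2^-1 <= 2 `^ tau2^-1 * P.
  rewrite powRM// ler_wpM2l// ge0_ler_powR ?nnegrE ?invr_ge0 ?(ltW tau20)//.
  - by rewrite addr_ge0.
  - by rewrite lerDr.
have := bound eps d eps0 d0; rewrite LE -(ler_int R) !intrD => /le_trans; apply.
have F := floor_le (M * expR 1 * d%:R `^ tau1).
have c1 := ltW (ceilB1_lt (C * d%:R `^ tau3)).
have c2 := ltW (ceilB1_lt ((2 * L) `^ tau2^-1)).
rewrite intrD in c1; rewrite intrD in c2.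
have QP : Q <= Q * P by rewrite ler_peMr// (le_trans ler01).
have PQ : P <= Q * P by rewrite ler_peMl// (le_trans ler01).
have h1 : M * expR 1 * d%:R `^ tau1 <= M * expR 1 * (Q * P).
  by rewrite ler_wpM2l// (le_trans Qt1).
have h2 : C * d%:R `^ tau3 <= C * (Q * P).
  by rewrite ler_wpM2l ?(ltW C0)// (le_trans Qt3).
have h3 : 2 `^ tau2^-1 * P <= 2 `^ tau2^-1 * (Q * P) by rewrite ler_wpM2l.
set f := (Num.floor _)%:~R in F *.
set g1 := (Num.ceil (C * _))%:~R in c1 *.
set g2 := (Num.ceil (_ `^ tau2^-1))%:~R in c2 *.
have m1 : (- 1)%:~R = - 1 :> R by [].
rewrite m1 in c1 c2; lra.
Qed.

Hypothesis lam_cvg0 : forall d, (0 < d)%N ->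
  forall c, 0 < c -> exists2 n, (0 < n)%N & lam d n <= c.

(** Take [eps = expR (- L)] with [(1 + L)^p' = j / D]. The assumed bound becomes [C / (C + 1) * j],
    strictly below [j], so monotonicity bounds the normalized eigenvalue of index [j] by [eps^2].
    The [1] in [C + 1] provides the strictness. *)
Lemma info_bound_decay C p p' q d j : 0 <= C -> p <= p' -> 0 < p' ->
  (forall eps : R, 0 < eps -> (info_complexity cri (lam d) eps)%:R <=
     C * d%:R `^ q * (1 + ln (Num.max 1 eps^-1)) `^ p) ->
  (0 < d)%N -> (C + 1) * d%:R `^ q <= j%:R ->
  lam d j / CRI cri (lam d) <=
    expR (2 - 2 * (j%:R / ((C + 1) * d%:R `^ q)) `^ p'^-1).
Proof.
move=> C0 pp' p'0 bound d0; set D := (C + 1) * _ => Dj.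
have dq0 : 0 < d%:R `^ q :> R by rewrite powR_gt0// ltr0n.
have D0 : 0 < D by rewrite mulr_gt0// ltr_wpDl.
pose L := (j%:R / D) `^ p'^-1 - 1.
have jD1 : 1 <= j%:R / D by rewrite ler_pdivlMr// mul1r.
have L0 : 0 <= L.
  by rewrite subr_ge0 -[leLHS](powRr0 (j%:R / D)) ler_powR// invr_ge0 ltW.
have eps0 := expR_gt0 (- L).
have Lp : (1 + L) `^ p' = j%:R / D.
  rewrite /L addrC subrK -powRrM mulVf ?gt_eqF// powRr1//.
  exact: le_trans jD1.
have infoj : (info_complexity cri (lam d) (expR (- L)) < j)%N.
  rewrite -(ltr_nat R); apply: le_lt_trans (bound _ eps0) _.
  rewrite expRN invrK max_r; last by rewrite -expR0 ler_expR.
  rewrite expRK.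
  apply: (@le_lt_trans _ _ (C * d%:R `^ q * (1 + L) `^ p')).
    by rewrite ler_wpM2l ?mulr_ge0 ?(ltW dq0)// ler_powR// lerDl.
  rewrite Lp mulrA ltr_pdivrMr// mulrC ltr_pM2l; last exact: lt_le_trans Dj.
  by rewrite ltr_pM2r// ltrDl ltr01.
have ge0 i := lam_ge0 d i d0; have dec i := lam_dec d i d0.
apply: le_trans (normalized_nonincr _ cri _ ge0 dec _ _ (ltn0Sn _) infoj) _.
apply: le_trans (info_complexity_attained _ cri _ ge0 dec _ eps0 (lam_cvg0 d d0)) _.
rewrite -expRM_natl ler_expR /L; lra.
Qed.

Lemma info_bound_partial_sum C p q r : 0 <= C -> 0 <= p -> p < r ->
  0 <= q ->
  (forall d (eps : R), (0 < d)%N -> 0 < eps ->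
    (info_complexity cri (lam d) eps)%:R <=
      C * d%:R `^ q * (1 + ln (Num.max 1 eps^-1)) `^ p) ->
  exists B tau : R, [/\ 0 <= B, 0 <= tau, q = 0 -> tau = 0 &
    forall d n, (0 < d)%N ->
      \sum_(cond_start q (C + 1) d <= j < n) cond_term r^-1 d j
        <= B * d%:R `^ tau].
Proof.
move=> C0 p0 pr q0 bound.
(* The midpoint is positive and above [p], as the inversion requires, and below [r], so that
   [r^-1 < p'^-1] leaves room for summable decay. *)
pose p' := (p + r) / 2.
have pp' : p < p' by rewrite /p'; lra.
have p'r : p' < r by rewrite /p'; lra.
have p'0 : 0 < p' := le_lt_trans p0 pp'.
have r0 : 0 < r := lt_trans p'0 p'r.
have tg : r^-1 < p'^-1 by rewrite ltf_pV2.
pose m := 2 / (p'^-1 - r^-1).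
have m0 : 0 < m by rewrite divr_gt0// subr_gt0.
have C1 : 0 < C + 1 by rewrite ltr_wpDl.
pose K := expR 2 * (m / 2) `^ m * (C + 1) `^ (p'^-1 * m).
have K0 : 0 <= K by rewrite !mulr_ge0 ?expR_ge0 ?powR_ge0.
(* The power of [d] comes from [D^(m / p')] with [D = (C + 1) * d^q]; the factor 2 bounds the sum of
   inverse squares. *)
exists (K * 2), (q * (p'^-1 * m)); split.
- by rewrite mulr_ge0.
- by rewrite mulr_ge0// mulr_ge0 ?(ltW m0)// invr_ge0 ltW.
- by move=> ->; rewrite mul0r.
move=> d n d0; set j0 := cond_start _ _ _.
have j00 : (0 < j0)%N by exact: cond_start_gt0.
have dq0 : 0 < d%:R `^ q :> R by rewrite powR_gt0// ltr0n.
have D0 : 0 < (C + 1) * d%:R `^ q by exact: mulr_gt0.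
apply: (@le_trans _ _ (\sum_(j0 <= j < n)
    K * d%:R `^ (q * (p'^-1 * m)) * (j%:R ^+ 2)^-1)).
  apply: ler_sum_nat => j /andP[j0j _].
  have jpos : (0 < j)%N := leq_trans j00 j0j.
  (* The sum starts at the ceiling of [D], so the decay estimate covers all its terms. *)
  have Dj : (C + 1) * d%:R `^ q <= j%:R.
    apply: le_trans (ceil_ge _) _; apply: (@le_trans _ _ j0%:R).
      by rewrite -[leRHS]/(j0%:~R) ler_int /j0 /cond_start abszE ler_norm.
    by rewrite ler_nat.
  have := decay_term_le _ _ _ _ _ _ jpos D0 _ tg
    (normalized_ge0 _ cri _ (lam_ge0 d ^~ d0) _ jpos)
    (info_bound_decay _ _ _ _ _ _ C0 (ltW pp') p'0 (bound d ^~ d0) d0 Dj).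
  rewrite invr_gt0 => /(_ r0) /le_trans; apply.
  by rewrite -/m (powRM _ (ltW C1) (ltW dq0)) -powRrM /K !mulrA.
rewrite -mulr_sumr [leRHS]mulrAC ler_wpM2l ?mulr_ge0 ?powR_ge0//.
exact: sum_inv_sqr_le2.
Qed.

End ComplexityBound.

(** * The tractability notions and the exponent *)

Section Tractability.
Variables (R : realType) (lam : nat -> nat -> R).
Implicit Types (cri : criterion) (C p q r : R).
Hypothesis lam_ge0 : forall d j, (0 < d)%N -> (0 < j)%N -> 0 <= lam d j.
Hypothesis lam_dec : forall d j, (0 < d)%N -> (0 < j)%N -> lam d j.+1 <= lam d j.
Hypothesis lam_cvg0 : forall d, (0 < d)%N ->
  forall c, 0 < c -> exists2 n, (0 < n)%N & lam d n <= c.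

Definition info_bound cri C p q : Prop :=
  forall d (eps : R), (0 < d)%N -> 0 < eps ->
    (info_complexity cri (lam d) eps)%:R <=
      C * d%:R `^ q * (1 + ln (Num.max 1 eps^-1)) `^ p.

Lemma EXP_SPT_withE cri p :
  EXP_SPT_with cri lam p <-> exists2 C, 0 <= C & info_bound cri C p 0.
Proof.
split=> [[C [C0 bound]]|[C C0 bound]]; exists C => //.
  by move=> d eps d0 eps0; rewrite powRr0 mulr1; exact: bound.
split=> // d eps d0 eps0.
by have := bound d eps d0 eps0; rewrite powRr0 mulr1.
Qed.

(** The clause [q = 0 -> tau = 0] lets one statement serve both polynomial and strong polynomial
    tractability. *)
Lemma info_bound_cond cri C p q r : 0 <= C -> 0 <= p -> p < r -> 0 <= q ->
  info_bound cri C p q ->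
  exists tau C', [/\ 0 <= tau, 0 < C', q = 0 -> tau = 0
    & cond cri lam tau r^-1 q C'].
Proof.
move=> C0 p0 pr q0 bound.
have [B [tau [B0 tau0 qtau sumB]]] := info_bound_partial_sum _ _ _
  lam_ge0 lam_dec lam_cvg0 _ _ _ _ C0 p0 pr q0 bound.
exists tau, (C + 1); split=> //; first by rewrite ltr_wpDl.
exact: cond_of_partial_sum sumB.
Qed.

(** Under NOR every term is at most 1, so the terms before the start index add at most that index,
    which is of order [d^q]. The sum may therefore begin at 1, at the price of a larger [tau]. *)
Lemma info_bound_cond_NOR C p q r : 0 <= C -> 0 <= p -> p < r -> 0 <= q ->
  info_bound NOR C p q ->
  exists tau, [/\ 0 <= tau, q = 0 -> tau = 0 & cond NOR lam tau r^-1 0 1].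
Proof.
move=> C0 p0 pr q0 bound.
have [B [tau [B0 tau0 qtau sumB]]] := info_bound_partial_sum _ _ _
  lam_ge0 lam_dec lam_cvg0 _ _ _ _ C0 p0 pr q0 bound.
exists (Num.max q tau); split.
- by rewrite le_max q0.
- by move=> q_eq0; rewrite (qtau q_eq0) q_eq0 maxxx.
apply: (cond_of_partial_sum _ _ _ _ _ _ _ (C + 2 + B)) => d n d0.
have d1 : (1 : R) <= d%:R by rewrite ler1n.
have -> : cond_start R 0 1 d = 1%N by rewrite /cond_start powRr0 mulr1 ceil1.
set j0 := cond_start R q (C + 1) d.
have j00 : (0 < j0)%N by rewrite cond_start_gt0// ltr_wpDl.
have Q1 : 1 <= d%:R `^ q :> R.
  by rewrite -[leLHS](powRr0 (d%:R : R)) ler_powR.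
have qmax : d%:R `^ q <= d%:R `^ Num.max q tau :> R.
  by rewrite ler_powR// le_max lexx.
have taumax : d%:R `^ tau <= d%:R `^ Num.max q tau :> R.
  by rewrite ler_powR// le_max lexx orbT.
have term1 j : (0 < j)%N -> cond_term R NOR lam r^-1 d j <= 1.
  move=> jpos.
  have ge0 i := lam_ge0 d i d0; have dec i := lam_dec d i d0.
  apply: (@le_trans _ _ (1 `^ (j%:R `^ (- r^-1)))); last by rewrite powR1.
  apply: ge0_ler_powR; rewrite ?powR_ge0 ?nnegrE//.
    exact: normalized_ge0.
  rewrite -le_CRI_normalized ?ler01// mul1r.
  exact: eigenvalue_seq_nonincr.
have head m : \sum_(1 <= j < m) cond_term R NOR lam r^-1 d j <= m%:R.
  apply: (@le_trans _ _ (\sum_(1 <= j < m) 1)).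
    by apply: ler_sum_nat => j /andP[jpos _]; exact: term1.
  by rewrite sumr_const_nat ler_nat leq_subr.
have j0C : j0%:R <= (C + 2) * d%:R `^ q.
  have start0 : 0 <= (C + 1) * d%:R `^ q by rewrite mulr_ge0 ?powR_ge0 ?addr_ge0.
  have := ltW (ceilB1_lt ((C + 1) * d%:R `^ q)).
  rewrite intrD.
  have -> : (Num.ceil ((C + 1) * d%:R `^ q))%:~R = j0%:R :> R.
    rewrite -[RHS]/(j0%:~R) /j0 /cond_start gez0_abs// ceil_ge0.
    exact: lt_le_trans (ltrN10 R) start0.
  have -> : (- 1)%:~R = - 1 :> R by [].
  by move=> h; lra.
have C2 : 0 <= C + 2 by lra.
have hq := ler_wpM2l C2 qmax.
have ht := ler_wpM2l B0 taumax.
have [nj|jn] := leqP n j0.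
  have nj0 : n%:R <= j0%:R :> R by rewrite ler_nat.
  have := head n; have := mulr_ge0 B0 (powR_ge0 (d%:R : R) tau).
  by move=> h1 h2; lra.
rewrite (@big_cat_nat _ _ _ j0)//=; last exact: ltnW.
by have h1 := head j0; have h2 := sumB d n d0; lra.
Qed.

Lemma cond_EXP_SPT_with cri tau2 C : 0 < tau2 -> 0 < C ->
  cond cri lam 0 tau2 0 C -> EXP_SPT_with cri lam tau2^-1.
Proof.
move=> tau20 C0 lam_cond; apply/EXP_SPT_withE.
have [B B0 bound] := cond_info_complexity_le _ _ _ lam_ge0 lam_dec _ _ _ _
  (lexx 0) tau20 (lexx 0) C0 lam_cond.
by exists B => // d eps d0 eps0; have := bound d eps d0 eps0; rewrite maxxx.
Qed.

Lemma cond_EXP_PT cri tau1 tau2 tau3 C :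
  0 <= tau1 -> 0 < tau2 -> 0 <= tau3 -> 0 < C ->
  cond cri lam tau1 tau2 tau3 C -> EXP_PT cri lam.
Proof.
move=> tau10 tau20 tau30 C0 lam_cond.
have [B B0 bound] := cond_info_complexity_le _ _ _ lam_ge0 lam_dec _ _ _ _
  tau10 tau20 tau30 C0 lam_cond.
exists B, tau2^-1, (Num.max tau1 tau3).
by split=> //; [rewrite invr_ge0 ltW | rewrite le_max tau10].
Qed.

(** [E] lies among the admissible exponents and contains everything strictly above any of them, so
    the infima agree whether or not they are attained. *)
Lemma EXP_SPT_exponentE cri (E : set R) :
  (forall r, E r -> 0 < r /\ EXP_SPT_with cri lam r) ->
  (forall p r, 0 <= p -> EXP_SPT_with cri lam p -> p < r -> E r) ->
  EXP_SPT cri lam -> EXP_SPT_exponent cri lam = inf E.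
Proof.
move=> Esub Esup [p0 [p00 sp0]].
have Elb : lbound E 0 by move=> r /Esub[/ltW].
have E0 : E !=set0 by exists (p0 + 1); apply: Esup p00 sp0 _; rewrite ltrDl.
apply/eqP; rewrite eq_le; apply/andP; split.
  apply: lb_le_inf => // r /Esub[r0 sr]; apply: ge_inf.
    by exists 0 => x [].
  by split=> //; exact: ltW.
apply: lb_le_inf; first by exists p0.
move=> p [p_ge0 sp]; apply/ler_addgt0Pr => e e0; apply: ge_inf.
  by exists 0.
by apply: Esup p_ge0 sp _; rewrite ltrDl.
Qed.

End Tractability.

(** * The four characterizations and the two exponent formulas *)

Theorem theorem1 (R : realType) (H G : nat -> hilbertType R)
    (S : forall d : nat, {linear H d -> G d})
    (Sadj : forall d : nat, G d -> H d)
    (lam : nat -> nat -> R)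
    (S_compact : forall d, (0 < d)%N -> compact_op (S d))
    (S_adjoint : forall d, (0 < d)%N -> adjoint_of (S d) (Sadj d))
    (lam_eig : forall d, (0 < d)%N ->
       eigenvalue_seq (fun f : H d => Sadj d (S d f)) (lam d)) :
  let S_nonzero := forall d, (0 < d)%N -> nonzero_op (S d) in
  (* (i) *)
  ((EXP_PT ABS lam <->
      exists tau1 tau2 tau3 C : R,
        [/\ 0 <= tau1, 0 < tau2, 0 <= tau3, 0 < C
          & cond ABS lam tau1 tau2 tau3 C]) /\
   (forall tau1 tau2 tau3 C : R,
      0 <= tau1 -> 0 < tau2 -> 0 <= tau3 -> 0 < C ->
      cond ABS lam tau1 tau2 tau3 C ->
      complexity_bound ABS lam tau1 tau2 tau3 C)) /\
  (* (ii) *)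
  (S_nonzero ->
   (EXP_PT NOR lam <->
      exists tau1 tau2 : R,
        [/\ 0 <= tau1, 0 < tau2 & cond NOR lam tau1 tau2 0 1]) /\
   (forall tau1 tau2 : R, 0 <= tau1 -> 0 < tau2 ->
      cond NOR lam tau1 tau2 0 1 ->
      complexity_bound NOR lam tau1 tau2 0 1)) /\
  (* (iii) *)
  ((EXP_SPT ABS lam <->
      exists tau2 C : R, [/\ 0 < tau2, 0 < C & cond ABS lam 0 tau2 0 C]) /\
   (forall tau2 C : R, 0 < tau2 -> 0 < C ->
      cond ABS lam 0 tau2 0 C -> complexity_bound ABS lam 0 tau2 0 C) /\
   (EXP_SPT ABS lam ->
      EXP_SPT_exponent ABS lam =
        inf [set tau2^-1 | tau2 in
              [set tau2 : R | 0 < tau2 /\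
                 exists C : R, 0 < C /\ cond ABS lam 0 tau2 0 C]])) /\
  (* (iv) *)
  (S_nonzero ->
   (EXP_SPT NOR lam <->
      exists tau2 : R, 0 < tau2 /\ cond NOR lam 0 tau2 0 1) /\
   (forall tau2 : R, 0 < tau2 ->
      cond NOR lam 0 tau2 0 1 -> complexity_bound NOR lam 0 tau2 0 1) /\
   (EXP_SPT NOR lam ->
      EXP_SPT_exponent NOR lam =
        inf [set tau2^-1 | tau2 in
              [set tau2 : R | 0 < tau2 /\ cond NOR lam 0 tau2 0 1]])).
Proof.
move=> S_nonzero.
have lam_ge0 d j : (0 < d)%N -> (0 < j)%N -> 0 <= lam d j.
  by move=> d0; have [+ _ _] := lam_eig d d0; apply.
have lam_dec d j : (0 < d)%N -> (0 < j)%N -> lam d j.+1 <= lam d j.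
  by move=> d0; have [_ + _] := lam_eig d d0; apply.
have lam_cvg0 d : (0 < d)%N -> forall c, 0 < c ->
    exists2 n, (0 < n)%N & lam d n <= c.
  move=> d0; exact: (eigenvalue_seq_cvg0 _ _ _ _ _ (S_adjoint d d0) _
    (lam_eig d d0) (S_compact d d0)).
have SPT_cond cri p r : 0 <= p -> EXP_SPT_with cri lam p -> p < r ->
    exists2 C, 0 < C & cond cri lam 0 r^-1 0 C.
  move=> p0 /EXP_SPT_withE[C C0 bound] pr.
  have [tau [C' [_ C'0 tau0 c]]] := info_bound_cond _ _
    lam_ge0 lam_dec lam_cvg0 _ _ _ _ _ C0 p0 pr (lexx 0) bound.
  by exists C' => //; rewrite tau0 in c.
have SPT_cond_NOR p r : 0 <= p -> EXP_SPT_with NOR lam p -> p < r ->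
    cond NOR lam 0 r^-1 0 1.
  move=> p0 /EXP_SPT_withE[C C0 bound] pr.
  have [tau [_ tau0 c]] := info_bound_cond_NOR _ _
    lam_ge0 lam_dec lam_cvg0 _ _ _ _ C0 p0 pr (lexx 0) bound.
  by rewrite tau0 in c.
have bound cri := cond_complexity_bound _ cri _ lam_ge0 lam_dec.
(* For the existence claims any [r > p] serves; [r = p + 1] gives [tau2 = (p + 1)^-1]. *)
have p1 (p : R) : p < p + 1 by rewrite ltrDl.
have invp1 (p : R) : 0 <= p -> 0 < (p + 1)^-1.
  by move=> p0; rewrite invr_gt0 ltr_wpDl.
split; [split|split; [move=> _; split|split; [split; [|split]|
  move=> _; split; [|split]]]].
- split=> [[C [p [q [C0 p0 q0 info]]]]|].
    have [tau [C' [tau0 C'0 _ c]]] := info_bound_cond _ _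
      lam_ge0 lam_dec lam_cvg0 _ _ _ _ _ C0 p0 (p1 p) q0 info.
    by exists tau, (p + 1)^-1, q, C'; split=> //; exact: invp1.
  move=> [tau1 [tau2 [tau3 [C [tau10 tau20 tau30 C0 c]]]]].
  exact: cond_EXP_PT c.
- by move=> tau1 tau2 tau3 C _ tau20 _ C0; exact: bound.
- split=> [[C [p [q [C0 p0 q0 info]]]]|].
    have [tau [tau0 _ c]] := info_bound_cond_NOR _ _
      lam_ge0 lam_dec lam_cvg0 _ _ _ _ C0 p0 (p1 p) q0 info.
    by exists tau, (p + 1)^-1; split=> //; exact: invp1.
  by move=> [tau1 [tau2 [tau10 tau20 c]]]; exact: cond_EXP_PT c.
- by move=> tau1 tau2 _ tau20; exact: bound.
- split=> [[p [p0 sp]]|[tau2 [C [tau20 C0 c]]]].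
    have [C C0 c] := SPT_cond _ _ _ p0 sp (p1 p).
    by exists (p + 1)^-1, C; split=> //; exact: invp1.
  exists tau2^-1; split; first by rewrite invr_ge0 ltW.
  exact: cond_EXP_SPT_with c.
- by move=> tau2 C; exact: bound.
- apply: EXP_SPT_exponentE => [_ [tau2 [tau20 [C [C0 c]]] <-]|p r p0 sp pr].
    by split; [rewrite invr_gt0 | exact: cond_EXP_SPT_with c].
  have r0 := le_lt_trans p0 pr.
  have [C C0 c] := SPT_cond _ _ _ p0 sp pr.
  exists r^-1; last by rewrite invrK.
  by split; [rewrite invr_gt0 | exists C].
- split=> [[p [p0 sp]]|[tau2 [tau20 c]]].
    exists (p + 1)^-1; split; first exact: invp1.
    exact: SPT_cond_NOR sp (p1 p).
  exists tau2^-1; split; first by rewrite invr_ge0 ltW.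
  exact: cond_EXP_SPT_with c.
- by move=> tau2 tau20; exact: bound.
- apply: EXP_SPT_exponentE => [_ [tau2 [tau20 c] <-]|p r p0 sp pr].
    by split; [rewrite invr_gt0 | exact: cond_EXP_SPT_with c].
  have r0 := le_lt_trans p0 pr.
  exists r^-1; last by rewrite invrK.
  by split; [rewrite invr_gt0 | exact: SPT_cond_NOR sp pr].
Qed.
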